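(* Let $f_-,f_+\in\mathcal{C}^1(\mathbb{R})$ with $f_\pm'$ Lipschitz continuous (and finitely many inflection points), and let $u$, $u_\pm$, $\mathcal{U}$, $\mathcal{U}_{\pm\infty}$ be the outer limit, its traces at $\xi=0\pm$, the inner limit profile and its limits at $\pm\infty$, as defined in the context, for Riemann data $(u_L,u_R)$. Then: (a) The right trace $u_+$ and the endpoint $\mathcal{U}_{+\infty}$ satisfy $(u_R-u_L)(u_+-\mathcal{U}_{+\infty})\ge0$ and $f_+(\mathcal{U}_{+\infty})=f_+(u_+)$, together with $$\operatorname{sgn}(u_+-k)\,(f_+(u_+)-f_+(k))\le0,\qquad \operatorname{sgn}(\mathcal{U}_{+\infty}-k)\,(f_+(\mathcal{U}_{+\infty})-f_+(k))\ge0$$ for all $k$ in the closed interval with endpoints $\mathcal{U}_{+\infty}$ and $u_+$. In particular, as soon as $\mathcal{U}_{+\infty}\ne u_+$, one has $f_+'(\mathcal{U}_{+\infty})\ge0$ and $f_+'(u_+)\le0$, with strict inequalities if the flux $f_+$ is genuinely nonlinear. (b) The left trace $u_-$ and the endpoint $\mathcal{U}_{-\infty}$ satisfy $(u_R-u_L)(\mathcal{U}_{-\infty}-u_-)\ge0$ and $f_-(u_-)=f_-(\mathcal{U}_{-\infty})$, together with $$\operatorname{sgn}(u_--k)\,(f_-(u_-)-f_-(k))\ge0,\qquad \operatorname{sgn}(\mathcal{U}_{-\infty}-k)\,(f_-(\mathcal{U}_{-\infty})-f_-(k))\le0$$ for all $k$ in the closed interval with endpoints $u_-$ and $\mathcal{U}_{-\infty}$.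 In particular, as soon as $\mathcal{U}_{-\infty}\ne u_-$, one has $f_-'(u_-)\ge0$ and $f_-'(\mathcal{U}_{-\infty})\le0$, with strict inequalities if the flux $f_-$ is genuinely nonlinear. (c) In addition, in the case of a non trivial inner solution, the endpoints $\mathcal{U}_{-\infty}\ne\mathcal{U}_{+\infty}$ satisfy $(u_R-u_L)(\mathcal{U}_{+\infty}-\mathcal{U}_{-\infty})>0$ and $$f_-'(\mathcal{U}_{-\infty})\ge0,\qquad f_+'(\mathcal{U}_{+\infty})\le0.$$
   Context: Given $(u_L,u_R)\in\mathbb{R}^2$, $M>0$ is $M=\sup_{u}\left(|f_-'(u)|+|f_+'(u)|\right)$, the supremum being over the closed interval with endpoints $u_L,u_R$. For $\epsilon>0$, $(u^\epsilon,v^\epsilon)$ is a solution on $[-M,M]$ of $$-\xi \frac{du^\epsilon}{d\xi} + \tfrac12\left((1-v^\epsilon)f_-'(u^\epsilon)+(1+v^\epsilon) f_+'(u^\epsilon)\right)\frac{du^\epsilon}{d\xi} = \epsilon \frac{d^2u^\epsilon}{d\xi^2},\qquad -\xi \frac{dv^\epsilon}{d\xi} = \epsilon^2 \frac{d^2v^\epsilon}{d\xi^2},$$ with $u^\epsilon(-M)=u_L$, $u^\epsilon(M)=u_R$, $v^\epsilon(-M)=-1$, $v^\epsilon(M)=+1$, extended by these constants outside $[-M,M]$. Set $\mathcal{U}^\epsilon(y)=u^\epsilon(\epsilon y)$, $\mathcal{V}^\epsilon(y)=v^\epsilon(\epsilon y)$. Along a common subsequence $\epsilon\to0$, $u^\epsilon\to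 u$ and $\mathcal{U}^\epsilon\to\mathcal{U}$ in $L^1_{\mathrm{loc}}(\mathbb{R})$, where $u\in L^\infty\cap BV$ (a coupled Riemann-Dafermos solution) is monotone, with traces $u_\pm=u(0\pm)$, and $\mathcal{U}\in\mathcal{C}^2(\mathbb{R})$ is bounded and monotone with limits $\mathcal{U}_{\pm\infty}$ at $\pm\infty$ and solves $\tfrac12\left((1-\mathcal{V})f_-'(\mathcal{U})+(1+\mathcal{V})f_+'(\mathcal{U})\right)\mathcal{U}'=\mathcal{U}''$ with $\mathcal{V}(y)=-1+2\int_{-\infty}^y e^{-s^2/2}ds\big/\int_{-\infty}^{+\infty} e^{-s^2/2}ds$. The inner solution is non trivial if $\mathcal{U}'(y)\neq0$ for all $y\in\mathbb{R}$ (otherwise $\mathcal{U}$ is constant). ''Genuinely nonlinear'' means strictly convex or strictly concave. *)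

(* Defs.v *)
From HB Require Import structures.
From mathcomp Require Import all_boot all_order all_algebra.
From mathcomp Require Import all_classical all_reals all_analysis.

Set Implicit Arguments.
Unset Strict Implicit.
Unset Printing Implicit Defensive.

Import Order.TTheory GRing.Theory Num.Theory.
Import numFieldNormedType.Exports.

Local Open Scope classical_set_scope.
Local Open Scope ring_scope.

Section Flux.
Context {R : realType}.
Implicit Types (f : R -> R) (A : set R).

Definition C1 f : Prop := (forall x, derivable f x 1) /\ continuous (derive1 f).

Definition C2 f : Prop := (forall x, derivable f x 1) /\ C1 (derive1 f).

Definition strictly_convex_on A f : Prop :=
  forall x y t, A x -> A y -> x != y -> 0 < t < 1 ->
    f (t * x + (1 - t) * y) < t * f x + (1 - t) * f y.

Definition strictly_concave_on A f : Prop :=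
  strictly_convex_on A (fun x => - f x).

Definition genuinely_nonlinear f : Prop :=
  strictly_convex_on setT f \/ strictly_concave_on setT f.

(* Strictness on both sides, so that an affine flux has no inflection point. *)
Definition inflection_point f (c : R) : Prop :=
  exists2 d : R, 0 < d &
    (strictly_convex_on `[c - d, c] f /\ strictly_concave_on `[c, c + d] f) \/
    (strictly_concave_on `[c - d, c] f /\ strictly_convex_on `[c, c + d] f).

Definition admissible_flux f : Prop :=
  [/\ C1 f, lipschitz (derive1 f) & finite_set (inflection_point f)].

Definition monotone_fun f : Prop :=
  {homo f : x y / x <= y} \/ {homo f : x y /~ x <= y}.

(* Bounded variation on the whole line. *)
Definition BV f : Prop :=
  exists C : R, forall a b : R, a <= b -> (total_variation a b f <= C%:E)%E.

(* The closed interval whose endpoints are a and b, in either order. *)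
Definition hull2 (a b : R) : set R := `[Num.min a b, Num.max a b].

End Flux.

Section Coupling.
Context {R : realType}.
Variables (fm fp : R -> R).
Local Notation mu := (@lebesgue_measure R).

Definition max_speed (uL uR : R) : R :=
  sup [set `|derive1 fm w| + `|derive1 fp w| | w in hull2 uL uR].

Definition coupled_speed (v u : R) : R :=
  2^-1 * ((1 - v) * derive1 fm u + (1 + v) * derive1 fp u).

(* A classical solution of the two-point boundary value problem on [-M, M],
   together with its extension by constants. *)
Definition dafermos_solution (uL uR M eps : R) (u v : R -> R) : Prop :=
  [/\ {within `[- M, M], continuous u} /\ {within `[- M, M], continuous v},
      forall xi : R, - M < xi < M ->
        [/\ derivable u xi 1, derivable (derive1 u) xi 1 &
            - xi * derive1 u xi + coupled_speed (v xi) (u xi) * derive1 u xi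
              = eps * derive1 (derive1 u) xi],
      forall xi : R, - M < xi < M ->
        [/\ derivable v xi 1, derivable (derive1 v) xi 1 &
            - xi * derive1 v xi = eps ^+ 2 * derive1 (derive1 v) xi],
      forall xi : R, xi <= - M -> u xi = uL /\ v xi = -1 &
      forall xi : R, M <= xi -> u xi = uR /\ v xi = 1].

Definition cvg_L1loc (F : nat -> R -> R) (f : R -> R) : Prop :=
  [/\ forall n, locally_integrable setT (F n),
      locally_integrable setT f &
      forall K : set R, compact K ->
        (\int[mu]_(x in K) `|F n x - f x|%:E)%E @[n --> \oo] --> 0%E].

(* u and U are the limits, along a common sequence eps_n -> 0, of a family of
   viscous solutions in the outer variable xi and the inner variable
   y = xi / eps. *)
Definition outer_inner_limits (uL uR M : R) (u U : R -> R) : Prop :=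
  exists ue ve : R -> R -> R, exists eps : nat -> R,
    [/\ forall e : R, 0 < e -> dafermos_solution uL uR M e (ue e) (ve e),
        forall n, 0 < eps n,
        eps n @[n --> \oo] --> 0,
        cvg_L1loc (fun n => ue (eps n)) u &
        cvg_L1loc (fun n y => ue (eps n) (eps n * y)) U].

Definition inner_color (y : R) : R :=
  -1 + 2 * ((\int[mu]_(s in `]-oo, y]) expR (- (s ^+ 2 / 2)))
            / (\int[mu]_(s in setT) expR (- (s ^+ 2 / 2)))).

Definition inner_profile (U : R -> R) : Prop :=
  [/\ C2 U, bounded_fun U, monotone_fun U &
      forall y : R, coupled_speed (inner_color y) (U y) * derive1 U y
                = derive1 (derive1 U) y].

Definition nontrivial_inner (U : R -> R) : Prop := forall y, derive1 U y != 0.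

End Coupling.

(* Main.v *)
Require Import Defs.
From HB Require Import structures.
From mathcomp Require Import all_boot all_order all_algebra.
From mathcomp Require Import all_classical all_reals all_analysis.
From mathcomp Require Import measurable_realfun ring lra.

Set Implicit Arguments.
Unset Strict Implicit.

Import Order.TTheory GRing.Theory Num.Theory.
Import numFieldNormedType.Exports.

Local Open Scope classical_set_scope.
Local Open Scope ring_scope.

(** Let p be the derivative of a viscous solution u. The equation of u says
    that e p' = (c(x) - x) p with a bounded coefficient c, so p cannot change
    sign (Gronwall, [linear_ode_lt0]): u is monotone, in the direction of
    uR - uL. The colour v is nondecreasing for the same reason, and its equation
    gives the elementary bound 1 - v(x) <= 2 e^2 / x^2 for x > 0
    ([wave_color_tail]). Right of the origin the coupled equation is therefore a
    perturbation of the viscous conservation law with flux fp: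
      (e p - fp(u))' = ((1 - v)/2 (fm' - fp')(u) - x) p,
    and on an interval [a, b] with 0 < a the bracket is at most
    L e^2 / a^2 + b ([wave_flux_balance]).

    Choose Y large, h small, and then e much smaller. By the mean value theorem
    e p is small at some a in ]e Y, 2 e Y[ and at some b in ]h, 2 h[, since u
    varies by at most |uR - uL|. Moreover u(a) is close to the inner limit Up,
    u(b) is close to the trace up, and e p - fp(u) is almost constant on [a, b].
    This is the property [viscous_layer]. Comparing the endpoints gives
    fp Up = fp up. If u is nondecreasing and k lies strictly between Up and up,
    then u takes the value k on [a, b], where e p >= 0; comparing with a gives
    fp k >= fp Up. The signs of the derivatives, and their strictness for a
    strictly concave flux, follow by bounding difference quotients at the two
    endpoints; a strictly convex flux is excluded when Up < up.

    Values pass to the limit because monotone functions that converge in L1loc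
    are uniformly close to a constant inside any interval on which their limit
    is close to it ([cvg_L1loc_monotone]).

    Two symmetries reduce everything to the nondecreasing case on the right:
    u -> - u with f -> - f(- .) ([coupled_wave_opp]), and x -> - x with v -> - v
    and (fm, fp) -> (- fp, - fm) ([coupled_wave_refl]).

    Finally the inner profile satisfies U'' = c U' with c(y) -> fp'(Up) as
    y -> +oo. A positive limit would bound |U'| away from 0 near +oo,
    contradicting that U is bounded ([bounded_profile_speed]). The direction of
    a nontrivial profile is inherited from u(e y) - u(- e y), which lies between
    0 and uR - uL ([wave_inner_range]). *)

(** * Differential inequalities and scalar linear equations *)

Lemma derive_continuous_itv (R : realType) (f df : R -> R) (a b : R) :
  (forall x, a <= x <= b -> is_derive x 1 f (df x)) ->
  {within `[a, b], continuous f}.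
Proof.
move=> fd; apply: derivable_within_continuous => x; rewrite in_itv /= => xab.
by have [] := fd _ xab.
Qed.

Lemma derive_mean_value (R : realType) (f df : R -> R) (a b : R) :
  a < b -> (forall x, a <= x <= b -> is_derive x 1 f (df x)) ->
  exists2 c, a < c < b & f b - f a = df c * (b - a).
Proof.
move=> ab fd.
have fd' x : x \in `]a, b[ -> is_derive x 1 f (df x).
  by rewrite in_itv /= => /andP[ax xb]; apply: fd; rewrite !ltW.
have [c cab e] := MVT ab fd' (derive_continuous_itv fd).
by exists c => //; move: cab; rewrite in_itv.
Qed.

Lemma derive_ge0_le (R : realType) (f df : R -> R) (a b : R) :
  a <= b -> (forall x, a <= x <= b -> is_derive x 1 f (df x)) ->
  (forall x, a <= x <= b -> 0 <= df x) -> f a <= f b.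
Proof.
rewrite le_eqVlt => /predU1P[-> //|ab] fd df0.
have [c /andP[ac cb] e] := derive_mean_value ab fd.
by rewrite -subr_ge0 e mulr_ge0 ?df0 ?subr_ge0 ?ltW.
Qed.

(** Both g - f and g + f are nondecreasing. *)
Lemma derive_abs_le (R : realType) (f df g dg : R -> R) (a b : R) :
  a <= b -> (forall x, a <= x <= b -> is_derive x 1 f (df x)) ->
  (forall x, a <= x <= b -> is_derive x 1 g (dg x)) ->
  (forall x, a <= x <= b -> `|df x| <= dg x) ->
  `|f b - f a| <= g b - g a.
Proof.
move=> ab fd gd le; rewrite ler_norml; apply/andP; split.
  suff : g a + f a <= g b + f b by lra.
  apply: (@derive_ge0_le _ (fun x => g x + f x) (fun x => dg x + df x)) => // x xab.
    by have ? := fd _ xab; have ? := gd _ xab; exact: is_deriveD.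
  by have := le _ xab; rewrite ler_norml; lra.
suff : g a - f a <= g b - f b by lra.
apply: (@derive_ge0_le _ (fun x => g x - f x) (fun x => dg x - df x)) => // x xab.
  by have ? := fd _ xab; have ? := gd _ xab; exact: is_deriveB.
by have := le _ xab; rewrite ler_norml; lra.
Qed.

Lemma is_derive_mulfun (R : realType) (f g : R -> R) (x a b : R) :
  is_derive x 1 f a -> is_derive x 1 g b ->
  is_derive x 1 (fun z => f z * g z) (a * g x + f x * b).
Proof.
move=> fa gb; apply: is_derive_eq.
by rewrite /= addrC; congr (_ + _); rewrite mulrC.
Qed.

Lemma is_derive_compfun (R : realType) (f g : R -> R) (x a b : R) :
  is_derive (g x) 1 f a -> is_derive x 1 g b ->
  is_derive x 1 (fun z => f (g z)) (a * b).
Proof. exact: is_derive1_comp. Qed.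

Lemma is_derive_lin (R : realType) (k x : R) :
  is_derive x 1 (fun z : R => k * z) k.
Proof. by apply: is_derive_eq; rewrite [LHS]mulr1. Qed.

(** A quantitative Gronwall argument: p^2 exp(- 2 K z) is nonincreasing and
    p^2 exp(2 K z) is nondecreasing, so a zero of p propagates both ways. *)
Lemma linear_ode_zero (R : realType) (p q : R -> R) (K a b x0 x : R) :
  (forall y, a < y < b -> is_derive y 1 p (q y * p y)) ->
  (forall y, a < y < b -> `|q y| <= K) ->
  a < x0 < b -> p x0 = 0 -> a < x < b -> p x = 0.
Proof.
move=> pd qK x0ab px0 xab.
have sqd (k y : R) : a < y < b ->
  is_derive y 1 (fun z => p z ^+ 2 * expR (k * z))
    ((2 * q y + k) * (p y ^+ 2 * expR (k * y))).
  move=> /pd pdy; have ed := is_derive_compfun (is_derive_expR (k * y)) (is_derive_lin k y).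
  apply: is_derive_eq (is_derive_mulfun (is_derive_mulfun pdy pdy) ed) _.
  by ring.
have e0 k y : 0 <= p y ^+ 2 * expR (k * y) by exact: mulr_ge0 (sqr_ge0 _) (expR_ge0 _).
have sq0 k : p x ^+ 2 * expR (k * x) <= 0 -> p x = 0.
  rewrite pmulr_lle0 ?expR_gt0// => h; apply/eqP.
  by rewrite -sqrf_eq0 eq_le h sqr_ge0.
have [xx0|x0x] := leP x0 x.
  apply: (sq0 (- (2 * K))); rewrite -lerN2 oppr0.
  have -> : 0 = - (p x0 ^+ 2 * expR (- (2 * K) * x0)) by rewrite px0; ring.
  apply: (@derive_ge0_le _ (fun z => - (p z ^+ 2 * expR (- (2 * K) * z)))
    (fun z => - ((2 * q z + - (2 * K)) * (p z ^+ 2 * expR (- (2 * K) * z))))) => // y yab.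
    have yab' : a < y < b by lra.
    by have ? := sqd (- (2 * K)) _ yab'; exact: is_deriveN.
  rewrite oppr_ge0 mulr_le0_ge0//.
  have /qK : a < y < b by lra.
  by rewrite ler_norml; lra.
apply: (sq0 (2 * K)).
have -> : 0 = p x0 ^+ 2 * expR ((2 * K) * x0) by rewrite px0; ring.
apply: (@derive_ge0_le _ (fun z => (p z ^+ 2 * expR ((2 * K) * z)))
    (fun z => ((2 * q z + (2 * K)) * (p z ^+ 2 * expR ((2 * K) * z))))); first exact: ltW.
  by move=> y yab; apply: sqd; lra.
move=> y yab; rewrite mulr_ge0//.
have /qK : a < y < b by lra.
by rewrite ler_norml; lra.
Qed.

(** A change of sign would create a zero of p, and p would then vanish
    identically. *)
Lemma linear_ode_lt0 (R : realType) (p q : R -> R) (K a b x0 x : R) :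
  (forall y, a < y < b -> is_derive y 1 p (q y * p y)) ->
  (forall y, a < y < b -> `|q y| <= K) ->
  a < x0 < b -> p x0 < 0 -> a < x < b -> p x < 0.
Proof.
move=> pd qK x0ab px0 xab; rewrite ltNge; apply/negP => px.
suff [z zab pz] : exists2 z, a < z < b & p z = 0.
  by move: px0; rewrite (linear_ode_zero pd qK zab pz x0ab) ltxx.
have cont c d : a < c -> d < b -> {within `[c, d], continuous p}.
  by move=> ac db; apply: (@derive_continuous_itv _ _ (fun y => q y * p y)) => y ?; apply: pd; lra.
have [xx0|x0x] := leP x0 x.
  have [||z] := @IVT _ p x0 x 0 xx0; last by rewrite in_itv /=; exists z => //; lra.
    by apply: cont; lra.
  by rewrite ge_min le_max (ltW px0) px orbT.
have [||z] := @IVT _ p x x0 0 (ltW x0x); last by rewrite in_itv /=; exists z => //; lra.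
  by apply: cont; lra.
by rewrite ge_min le_max (ltW px0) px orbT.
Qed.

Lemma within_continuous_bounded (R : realType) (f : R -> R) (a b : R) :
  a <= b -> {within `[a, b], continuous f} ->
  exists K, forall x, a <= x <= b -> `|f x| <= K.
Proof.
move=> ab cf; have cnf : {within `[a, b], continuous (fun x => `|f x|)}.
  by move=> x; apply: cvg_norm; exact: cf.
have [c _ fc] := EVT_max ab cnf.
by exists `|f c| => x xab; apply: fc; rewrite in_itv.
Qed.

(** Were p negative somewhere it would be negative everywhere, and u would
    be strictly decreasing from a to b. *)
Lemma linear_ode_derive_ge0 (R : realType) (u p q : R -> R) (K a b : R) :
  a < b -> {within `[a, b], continuous u} ->
  (forall x, a < x < b -> is_derive x 1 u (p x)) ->
  (forall x, a < x < b -> is_derive x 1 p (q x * p x)) ->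
  (forall x, a < x < b -> `|q x| <= K) ->
  u a <= u b -> forall x, a < x < b -> 0 <= p x.
Proof.
move=> ab cu ud pd qK uab x xab; rewrite leNgt; apply/negP => px.
have ud' z : z \in `]a, b[ -> is_derive z 1 u (p z) by rewrite in_itv; exact: ud.
have [c] := MVT ab ud' cu; rewrite in_itv /= => cab uE.
have pc := linear_ode_lt0 pd qK xab px cab.
have := nmulr_rlt0 (b - a) pc; rewrite -uE subr_gt0 ab.
by rewrite ltNge subr_ge0 uab.
Qed.

Lemma derive_ge0_nondecreasing (R : realType) (u p : R -> R) (a b : R) :
  {within `[a, b], continuous u} ->
  (forall x, a < x < b -> is_derive x 1 u (p x)) ->
  (forall x, a < x < b -> 0 <= p x) ->
  forall x y, a <= x -> x <= y -> y <= b -> u x <= u y.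
Proof.
move=> cu ud p0 x y ax xy yb.
have ud' z : z \in `]x, y[ -> is_derive z 1 u (p z).
  by rewrite in_itv /= => ?; apply: ud; lra.
have cu' : {within `[x, y], continuous u}.
  by apply: continuous_subspaceW cu; apply: subset_itv; rewrite bnd_simp.
have [eqxy|xy'] := eqVneq x y; first by rewrite eqxy.
have ltxy : x < y by rewrite lt_neqAle xy'.
have [c] := MVT ltxy ud' cu'; rewrite in_itv /= => cxy uE.
by rewrite -subr_ge0 uE mulr_ge0 ?p0//; lra.
Qed.

(** * Viscous solutions and their symmetries *)

(** The viscous problem with the derivatives p of u and q of v, and the speeds
    gm and gp, named. As derive1 is only meaningful where a function is
    derivable, naming derivatives is what makes the symmetries
    [coupled_wave_opp] and [coupled_wave_refl] immediate. *)
Record coupled_wave (R : realType) (gm gp : R -> R) (uL uR M e : R)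
    (u p v q : R -> R) : Prop := CoupledWave {
  wave_contu : {within `[- M, M], continuous u};
  wave_contv : {within `[- M, M], continuous v};
  wave_u : forall x, - M < x < M -> is_derive x 1 u (p x);
  wave_p : forall x, - M < x < M -> is_derive x 1 p
    ((2^-1 * ((1 - v x) * gm (u x) + (1 + v x) * gp (u x)) - x) / e * p x);
  wave_v : forall x, - M < x < M -> is_derive x 1 v (q x);
  wave_q : forall x, - M < x < M -> is_derive x 1 q (- x / e ^+ 2 * q x);
  wave_left : forall x, x <= - M -> u x = uL /\ v x = -1;
  wave_right : forall x, M <= x -> u x = uR /\ v x = 1 }.

Lemma within_continuous_comp_opp (R : realType) (M : R) (f : R -> R) :
  0 < M -> {within `[- M, M], continuous f} ->
  {within `[- M, M], continuous (fun x => f (- x))}.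
Proof.
move=> M0 cf; have NM : - M < M by lra.
have [ci cl cr] := (continuous_within_itvP f NM).1 cf.
apply/(continuous_within_itvP _ NM); split.
- move=> x xM; apply: (@continuous_comp _ _ _ -%R f); first exact: opp_continuous.
  by apply: ci; move: xM; rewrite !in_itv /= => ?; lra.
- by have /cvg_at_leftNP := cr; rewrite opprK.
- by have /cvg_at_rightNP := cl; rewrite opprK.
Qed.

Lemma is_derive_comp_opp (R : realType) (f : R -> R) (x a : R) :
  is_derive (- x) 1 f a -> is_derive x 1 (fun z => f (- z)) (- a).
Proof.
move=> fa; have idN : is_derive x 1 (-%R : R -> R) (-1) by exact: is_deriveN.
by rewrite -mulrN1; exact: (is_derive_compfun (g := -%R)).
Qed.

Lemma coupled_wave_opp (R : realType) (gm gp : R -> R) (uL uR M e : R)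
    (u p v q : R -> R) :
  coupled_wave gm gp uL uR M e u p v q ->
  coupled_wave (fun w => gm (- w)) (fun w => gp (- w)) (- uL) (- uR) M e
    (fun x => - u x) (fun x => - p x) v q.
Proof.
case=> cu cv ud pd vd qd lft rgt; split=> //.
- by move=> x; apply: cvgN; exact: cu.
- by move=> x xM; have ? := ud x xM; exact: is_deriveN.
- move=> x xM; have ? := pd x xM.
  by rewrite mulrN opprK; exact: is_deriveN.
- by move=> x /lft[-> ->].
- by move=> x /rgt[-> ->].
Qed.

Lemma coupled_wave_refl (R : realType) (gm gp : R -> R) (uL uR M e : R)
    (u p v q : R -> R) : 0 < M -> 0 < e ->
  coupled_wave gm gp uL uR M e u p v q ->
  coupled_wave (fun w => - gp w) (fun w => - gm w) uR uL M e
    (fun x => u (- x)) (fun x => - p (- x)) (fun x => - v (- x))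
    (fun x => q (- x)).
Proof.
move=> M0 e0; case=> cu cv ud pd vd qd lft rgt.
have oM x : - M < x < M -> - M < - x < M by move=> ?; lra.
split.
- exact: within_continuous_comp_opp.
- by have cv' := within_continuous_comp_opp M0 cv; move=> x; apply: cvgN; exact: cv'.
- by move=> x /oM/ud/is_derive_comp_opp.
- move=> x /oM/pd/is_derive_comp_opp d; apply: is_derive_eq (is_deriveN d) _.
  by rewrite opprK; field; rewrite gt_eqF.
- by move=> x /oM/vd/is_derive_comp_opp d; apply: is_derive_eq (is_deriveN d) _; rewrite opprK.
- by move=> x /oM/qd/is_derive_comp_opp d; apply: is_derive_eq d _; rewrite !mulNr opprK.
- by move=> x xM; have [|-> ->] := rgt (- x); first lra.
- by move=> x xM; have [|-> ->] := lft (- x); [lra|rewrite opprK].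
Qed.

(** * Monotonicity and flux balance of nondecreasing waves *)

Section wave.
Context (R : realType) (gm gp : R -> R) (uL uR M e : R) (u p v q : R -> R).
Hypotheses (M0 : 0 < M) (e0 : 0 < e) (LR : uL <= uR).
Hypotheses (cgm : continuous gm) (cgp : continuous gp).
Hypothesis W : coupled_wave gm gp uL uR M e u p v q.

Let NM : - M < M. Proof. by rewrite gtrN. Qed.

Let u_left : u (- M) = uL. Proof. by case: (wave_left W (lexx _)). Qed.
Let v_left : v (- M) = -1. Proof. by case: (wave_left W (lexx _)). Qed.
Let u_right : u M = uR. Proof. by case: (wave_right W (lexx _)). Qed.
Let v_right : v M = 1. Proof. by case: (wave_right W (lexx _)). Qed.

Lemma wave_p_ge0 x : - M < x < M -> 0 <= p x.
Proof.
have cu := wave_contu W; have cv := wave_contv W.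
pose s (z : R) := (2^-1 * ((1 - v z) * gm (u z) + (1 + v z) * gp (u z)) - z) / e.
have cs : {within `[- M, M], continuous s}.
  move=> z; apply: cvgM; last exact: cvg_cst.
  apply: cvgB; last first.
    by apply: (@continuous_subspaceT _ _ _ id) => y; exact: cvg_id.
  apply: cvgM; first exact: cvg_cst.
  apply: cvgD; (apply: cvgM; last (apply: cvg_comp; first exact: cu)).
  - by apply: cvgB; [exact: cvg_cst|exact: cv].
  - exact: cgm.
  - by apply: cvgD; [exact: cvg_cst|exact: cv].
  - exact: cgp.
have [K sK] := within_continuous_bounded (ltW NM) cs.
apply: (linear_ode_derive_ge0 NM cu (wave_u W) (wave_p W) (K := K)).
  by move=> z zM; apply: sK; rewrite !ltW//; case/andP: zM.
by rewrite u_left u_right.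
Qed.

Lemma wave_q_ge0 x : - M < x < M -> 0 <= q x.
Proof.
apply: (linear_ode_derive_ge0 NM (wave_contv W) (wave_v W) (wave_q W)
  (K := M / e ^+ 2)).
  move=> z zM; rewrite normrM normrN (ger0_norm (x := (e ^+ 2)^-1)) ?invr_ge0 ?sqr_ge0//.
  by rewrite ler_wpM2r ?invr_ge0 ?sqr_ge0// ler_norml; lra.
by rewrite v_left v_right; lra.
Qed.

Let extend_nondecreasing (f : R -> R) (l r : R) :
  (forall x, x <= - M -> f x = l) -> (forall x, M <= x -> f x = r) ->
  (forall x y, - M <= x -> x <= y -> y <= M -> f x <= f y) ->
  {homo f : x y / x <= y}.
Proof.
move=> fl fr fM.
(* c is the retraction onto [- M, M], through which f factors. *)
pose c (x : R) := Num.max (- M) (Num.min x M).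
have fc x : f x = f (c x).
  rewrite /c; have [xM|Mx] := leP x M; last by rewrite max_r ?fr// ltW.
  by have [xM'|//] := leP x (- M); rewrite !fl.
move=> x y xy; rewrite (fc x) (fc y); apply: fM; rewrite /c.
- by rewrite le_max lexx.
- by rewrite ge_max !le_max lexx /= le_min !ge_min lexx xy orbT orbT.
- by rewrite ge_max (ltW NM) ge_min lexx orbT.
Qed.

Lemma wave_nondecreasing : {homo u : x y / x <= y}.
Proof.
apply: (@extend_nondecreasing u uL uR).
- by move=> x /(wave_left W)[].
- by move=> x /(wave_right W)[].
- exact: (derive_ge0_nondecreasing (wave_contu W) (wave_u W) wave_p_ge0).
Qed.

Lemma wave_color_nondecreasing : {homo v : x y / x <= y}.
Proof.
apply: (@extend_nondecreasing v (-1) 1).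
- by move=> x /(wave_left W)[].
- by move=> x /(wave_right W)[].
- exact: (derive_ge0_nondecreasing (wave_contv W) (wave_v W) wave_q_ge0).
Qed.

Let nondecreasing_bound (f : R -> R) (l r : R) :
  (forall x, x <= - M -> f x = l) -> (forall x, M <= x -> f x = r) ->
  {homo f : x y / x <= y} -> forall x, l <= f x <= r.
Proof.
move=> fl fr fM x; apply/andP; split.
  by rewrite -(fl (Num.min x (- M))) ?fM ?ge_min ?lexx ?orbT.
by rewrite -(fr (Num.max x M)) ?fM ?le_max ?lexx ?orbT.
Qed.

Lemma wave_bound x : uL <= u x <= uR.
Proof.
apply: nondecreasing_bound wave_nondecreasing x => x.
  by case/(wave_left W).
by case/(wave_right W).
Qed.

Lemma wave_color_bound x : -1 <= v x <= 1.
Proof.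
apply: nondecreasing_bound wave_color_nondecreasing x => x.
  by case/(wave_left W).
by case/(wave_right W).
Qed.

Lemma wave_mean_value a b : - M < a -> a < b -> b < M ->
  exists2 c, a < c < b & u b - u a = p c * (b - a).
Proof.
move=> Ma ab bM; apply: derive_mean_value => // x xab.
by apply: (wave_u W); lra.
Qed.

(** Since q' = - x q / e^2, the function v + e^2 q / x is nonincreasing to the
    right of x when x is held fixed in the denominator, so
    1 - v(x) <= e^2 q(x) / x. As q is nonincreasing on the positive side,
    x q(x) is at most the increment of v on [0, x], hence at most 2. This
    replaces the Gaussian tail estimate. *)
Lemma wave_color_tail x : 0 < x < M -> 1 - v x <= 2 * e ^+ 2 / x ^+ 2.
Proof.
move=> /andP[x0 xM].
have [c cx vE] : exists2 c, 0 < c < x & v x - v 0 = q c * (x - 0).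
  by apply: derive_mean_value => // z ?; apply: (wave_v W); lra.
have qc : q x <= q c.
  rewrite -lerN2; apply: (@derive_ge0_le _ (fun z => - q z)
    (fun z => - (- z / e ^+ 2 * q z))) => [|z zcx|z zcx]; first lra.
    have zM : - M < z < M by lra.
    by have ? := wave_q W zM; exact: is_deriveN.
  rewrite !mulNr opprK; apply: mulr_ge0; last by apply: wave_q_ge0; lra.
  by apply: divr_ge0; [lra|exact: sqr_ge0].
have qx : q x * x <= 2.
  apply: (@le_trans _ _ (q c * x)); first by rewrite ler_pM2r.
  by have := wave_color_bound x; have := wave_color_bound 0; rewrite subr0 in vE; lra.
have tail y : x <= y < M -> v y <= v x + e ^+ 2 * q x / x.
  move=> /andP[xy yM].
  have q0 : 0 <= e ^+ 2 * q y / x.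
    by apply: divr_ge0 (ltW x0); apply: mulr_ge0; [exact: sqr_ge0|apply: wave_q_ge0; lra].
  suff : - (v x + e ^+ 2 / x * q x) <= - (v y + e ^+ 2 / x * q y) by lra.
  apply: (@derive_ge0_le _ (fun z => - (v z + e ^+ 2 / x * q z))
    (fun z => - (q z + e ^+ 2 / x * (- z / e ^+ 2 * q z)))) => // z zxy.
    have zM : - M < z < M by lra.
    have vz := wave_v W zM; have qz := wave_q W zM.
    have kz := is_derive_compfun (is_derive_lin (e ^+ 2 / x) _) qz.
    exact: is_deriveN.
  have -> : - (q z + e ^+ 2 / x * (- z / e ^+ 2 * q z)) = q z * (z - x) / x.
    by field; rewrite !gt_eqF.
  apply: divr_ge0 (ltW x0); apply: mulr_ge0; last by lra.
  by apply: wave_q_ge0; lra.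
have [_ _ vM] := (continuous_within_itvP v NM).1 (wave_contv W).
have vx : v M <= v x + e ^+ 2 * q x / x.
  apply: (cvgr_to_le vM); near=> y; apply: tail; apply/andP; split; near: y.
    exact: nbhs_left_ge.
  exact: nbhs_left_lt.
have : e ^+ 2 * q x / x <= 2 * e ^+ 2 / x ^+ 2.
  rewrite ler_pdivrMr// (_ : _ * x = 2 * e ^+ 2 / x); last by field; rewrite gt_eqF.
  by rewrite ler_pdivlMr// -mulrA (mulrC 2) ler_pM2l ?exprn_gt0.
by move: vx; rewrite v_right; lra.
Unshelve. all: by end_near. Qed.

(** The derivative of e p - fp(u) is ((1 - v)/2 (gm - gp)(u) - x) p, and p is
    the nonnegative derivative of u: bounding the bracket bounds the variation
    of e p - fp(u) by that of u. *)
Lemma wave_flux_balance (fp : R -> R) (L a b : R) :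
  (forall w : R, is_derive w 1 fp (gp w)) ->
  (forall w, uL <= w <= uR -> `|gm w - gp w| <= L) ->
  0 < a -> a <= b -> b < M ->
  `|(e * p b - fp (u b)) - (e * p a - fp (u a))|
    <= (L * e ^+ 2 / a ^+ 2 + b) * (u b - u a).
Proof.
move=> fpd gL a0 ab bM; rewrite [leRHS]mulrBr.
set K := (_ + b).
have L0 : 0 <= L by apply: le_trans (gL uL _); rewrite ?lexx.
refine (@derive_abs_le _ (fun x => e * p x - fp (u x))
  (fun x => ((1 - v x) / 2 * (gm (u x) - gp (u x)) - x) * p x)
  (fun x => K * u x) (fun x => K * p x) a b ab _ _ _) => x xab.
- have xM : - M < x < M by lra.
  have d1 := is_derive_compfun (is_derive_lin e _) (wave_p W xM).
  have d2 := is_derive_compfun (fpd _) (wave_u W xM).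
  apply: is_derive_eq (is_deriveB d1 d2) _.
  by field; rewrite gt_eqF.
- have xM : - M < x < M by lra.
  exact: is_derive_compfun (is_derive_lin _ _) (wave_u W xM).
have xM : - M < x < M by lra.
have x0 : 0 < x by lra.
rewrite normrM (ger0_norm (wave_p_ge0 xM)) ler_wpM2r ?wave_p_ge0//.
rewrite (le_trans (ler_normB _ _))// lerD//; last by rewrite gtr0_norm//; lra.
have /andP[_ v1] := wave_color_bound x.
rewrite normrM ger0_norm; last by lra.
have : (1 - v x) / 2 <= e ^+ 2 / a ^+ 2.
  have : e ^+ 2 / x ^+ 2 <= e ^+ 2 / a ^+ 2.
    rewrite ler_pM2l ?exprn_gt0// lef_pV2 ?posrE ?exprn_gt0//.
    by rewrite lerXn2r ?nnegrE; lra.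
  have x0M : 0 < x < M by lra.
  have := wave_color_tail x0M; lra.
move=> h; rewrite -mulrA (mulrC L); apply: ler_pM => //; first by lra.
by apply: gL; exact: wave_bound.
Qed.

End wave.

(** * The viscous layer between the two scales *)

(** Viscous profiles w of arbitrarily good quality connecting l to r for the flux
    f: p is the viscous term, which is nonnegative, nearly vanishes at both
    ends, and nearly balances f(w) - f(w a) inside. No convergence of profiles
    is asked for, only existence at each precision d. *)
Definition viscous_layer (R : realType) (f : R -> R) (l r : R) : Prop :=
  forall d : R, 0 < d -> exists w p : R -> R, exists a b : R,
    [/\ a <= b, {within `[a, b], continuous w}, w a <= w b,
        `|w a - l| <= d & `|w b - r| <= d] /\
    [/\ forall c, a <= c <= b -> 0 <= p c, p a <= d, p b <= d &
        forall c, a <= c <= b ->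
          `|(p c - f (w c)) - (p a - f (w a))| <= d].

Lemma continuous_modulus (R : realType) (f : R -> R) (x e : R) :
  {for x, continuous f} -> 0 < e ->
  exists2 d, 0 < d & forall w, `|w - x| <= d -> `|f w - f x| <= e.
Proof.
move=> /cvgrPdist_le cf e0; have /nbhs_ballP[d /= d0 fd] := cf _ e0.
exists (d / 2); first by rewrite divr_gt0.
move=> w wx; rewrite distrC; apply: fd; rewrite /ball /= distrC.
by apply: le_lt_trans wx _; rewrite ltr_pdivrMr// ltr_pMr// ltr1n.
Qed.

(** Balance between both ends gives f l = f r; balance between the left end and a
    point where w = k, where p >= 0, gives f l <= f k. *)
Lemma viscous_layer_flux (R : realType) (f : R -> R) (l r : R) :
  continuous f -> viscous_layer f l r ->
  [/\ l <= r, f l = f r & forall k, l <= k <= r -> f l <= f k].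
Proof.
move=> cf lay.
have lr : l <= r.
  apply/ler_addgt0Pr => d d0; have d20 : 0 < d / 2 by lra.
  have [w [p [a [b [[_ _ wab wa wb] _]]]]] := lay _ d20.
  by move: wa wb; rewrite !ler_norml; lra.
have flr : f l = f r.
  apply/eqP; rewrite -subr_eq0 -normr_le0; apply/ler_addgt0Pr => d d0; rewrite add0r.
  have d50 : 0 < d / 5 by lra.
  have [d1 d10 fl] := continuous_modulus (cf l) d50.
  have [d2 d20 fr] := continuous_modulus (cf r) d50.
  pose d3 := Num.min (d / 5) (Num.min d1 d2).
  have d30 : 0 < d3 by rewrite /d3 !lt_min d50 d10 d20.
  have [w [p [a [b [[ab _ _ wa wb] [p0 pa pb G]]]]]] := lay _ d30.
  move: wa wb pa pb; rewrite /d3 !le_min.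
  move=> /and3P[_ /fl fwa _] /and3P[_ _ /fr fwb] /and3P[pa _ _] /and3P[pb _ _].
  have aab : a <= a <= b by rewrite lexx.
  have bab : a <= b <= b by rewrite lexx andbT.
  have := G _ bab; rewrite /d3 !le_min => /and3P[Gb _ _].
  move: fwa fwb Gb; have := p0 _ aab; have := p0 _ bab.
  by rewrite !ler_norml; lra.
split=> // k /andP[]; rewrite le_eqVlt => /predU1P[-> //|lk].
rewrite le_eqVlt => /predU1P[->|kr]; first by rewrite flr.
apply/ler_addgt0Pr => d d0; have d30 : 0 < d / 3 by lra.
have [d1 d10 fl] := continuous_modulus (cf l) d30.
(* A precision below k - l and r - k forces w a <= k <= w b. *)
pose d3 := Num.min (Num.min (d / 3) d1) (Num.min (k - l) (r - k)).
have d3_0 : 0 < d3 by rewrite /d3 !lt_min d30 d10 !subr_gt0 lk kr.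
have [w [p [a [b [[ab cw _ wa wb] [p0 pa _ G]]]]]] := lay _ d3_0.
have [c] : exists2 c, c \in `[a, b] & w c = k.
  apply: IVT => //; rewrite ge_min le_max; apply/andP; split.
    by apply/orP; left; move: wa; rewrite /d3 !le_min !ler_norml; lra.
  by apply/orP; right; move: wb; rewrite /d3 !le_min !ler_norml; lra.
rewrite in_itv /= => cab wc.
move: wa pa; rewrite /d3 !le_min => /andP[/andP[_ /fl fwa] _] /andP[/andP[pa _] _].
have := G _ cab; rewrite /d3 !le_min wc => /andP[/andP[Gc _] _].
by move: fwa Gc; have := p0 _ cab; rewrite !ler_norml; lra.
Qed.

(** The points a, of the inner scale, and b, of the outer scale, are given by the
    mean value theorem, which makes e p small there. The inequalities on the
    constants make the inner and outer slopes, the departure of the colour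
    from 1 and the drift term x p negligible, and separate the two scales. *)
Lemma wave_transition (R : realType) (gm gp fp : R -> R)
    (uL uR M e L d h Y : R) (u p v q : R -> R) :
  0 < M -> 0 < e -> uL <= uR -> continuous gm -> continuous gp ->
  coupled_wave gm gp uL uR M e u p v q ->
  (forall w : R, is_derive w 1 fp (gp w)) ->
  (forall w, uL <= w <= uR -> `|gm w - gp w| <= L) ->
  0 < h -> 2 * h < M -> 2 * h * (uR - uL) <= d / 2 ->
  0 < Y -> (uR - uL) / Y <= d -> L / Y ^+ 2 * (uR - uL) <= d / 2 ->
  e * (uR - uL) <= d * h -> e * (2 * Y) <= h ->
  exists a b, [/\ e * Y < a < 2 * (e * Y), h < b < 2 * h & a < b] /\
    [/\ e * p a <= d, e * p b <= d & forall c, a <= c <= b ->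
      `|(e * p c - fp (u c)) - (e * p a - fp (u a))| <= d].
Proof.
move=> M0 e0 LR cgm cgp W fpd gL h0 hM hD Y0 YD YLD eD eY.
have L0 : 0 <= L by apply: le_trans (gL uL _); rewrite ?lexx.
have eY0 : 0 < e * Y by rewrite mulr_gt0.
have eYh : 2 * (e * Y) <= h by rewrite mulrCA.
have uB x y : u x - u y <= uR - uL.
  have /andP[_ ux] := wave_bound M0 LR cgm cgp W x.
  have /andP[uy _] := wave_bound M0 LR cgm cgp W y.
  exact: lerB.
have balance := wave_flux_balance M0 e0 LR cgm cgp W fpd gL.
have umono := wave_nondecreasing M0 LR cgm cgp W.
have mv := wave_mean_value W.
clear W fpd gL LR cgm cgp eY.
have [a aY ua] : exists2 a, e * Y < a < 2 * (e * Y) &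
    u (2 * (e * Y)) - u (e * Y) = p a * (2 * (e * Y) - e * Y).
  by apply: mv; lra.
have [b bh ub] : exists2 b, h < b < 2 * h & u (2 * h) - u h = p b * (2 * h - h).
  by apply: mv; lra.
have ab : a < b by lra.
exists a, b; split; split=> //.
- apply: le_trans YD; rewrite ler_pdivlMr//.
  by have := uB (2 * (e * Y)) (e * Y); rewrite ua; lra.
- rewrite -(ler_pM2r h0); apply: le_trans eD; rewrite -mulrA ler_pM2l//.
  by have := uB (2 * h) h; rewrite ub; lra.
- move=> c cab; have a0 : 0 < a by lra.
  have ac : a <= c by lra.
  have cM : c < M by lra.
  apply: le_trans (balance _ _ a0 ac cM) _.
  have uca : 0 <= u c - u a by rewrite subr_ge0; exact: umono.
  have ea : L * e ^+ 2 / a ^+ 2 <= L / Y ^+ 2.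
    rewrite ler_pdivrMr ?exprn_gt0// mulrAC -mulrA ler_wpM2l//.
    rewrite ler_pdivlMr ?exprn_gt0// -exprMn lerXn2r ?nnegrE ?ltW//.
    by case/andP: aY.
  apply: (@le_trans _ _ ((L / Y ^+ 2 + 2 * h) * (uR - uL))).
    apply: ler_pM => //.
      by apply: addr_ge0; [apply: divr_ge0; [apply: mulr_ge0|]; rewrite ?sqr_ge0|lra].
    by apply: lerD => //; lra.
  by rewrite mulrDl; lra.
Qed.

(** The constants of [wave_transition] are chosen in the order h, Y, n: h and Y
    control the outer and inner scales, and n, taken last, separates them. *)
Lemma wave_viscous_layer (R : realType) (gm gp fp : R -> R) (uL uR M l r : R)
    (e : nat -> R) (u p v q : nat -> R -> R) :
  0 < M -> uL <= uR -> continuous gm -> continuous gp ->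
  (forall w : R, is_derive w 1 fp (gp w)) ->
  (forall n, 0 < e n) -> e n @[n --> \oo] --> 0 ->
  (forall n, coupled_wave gm gp uL uR M (e n) (u n) (p n) (v n) (q n)) ->
  (forall d : R, 0 < d -> \forall h \near (0 : R)^'+, \forall n \near \oo,
    forall x, h <= x <= 2 * h -> `|u n x - r| <= d) ->
  (forall d : R, 0 < d -> \forall Y \near +oo, \forall n \near \oo,
    forall y, Y <= y <= 2 * Y -> `|u n (e n * y) - l| <= d) ->
  viscous_layer fp l r.
Proof.
move=> M0 LR cgm cgp fpd e0 ecvg W outer inner d d0.
have [L gL] : exists L, forall w, uL <= w <= uR -> `|gm w - gp w| <= L.
  apply: within_continuous_bounded => //; apply: continuous_subspaceT => w.
  by apply: cvgB; [exact: cgm|exact: cgp].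
have L0 : 0 <= L by apply: le_trans (gL uL _); rewrite ?lexx.
set D := uR - uL; have D0 : 0 <= D by rewrite subr_ge0.
have [h [h0 hM hD hr]] : exists h, [/\ 0 < h, 2 * h < M, 2 * h * D <= d / 2 &
    \forall n \near \oo, forall x, h <= x <= 2 * h -> `|u n x - r| <= d].
  have k0 : 0 < Num.min (M / 2) (d / 4 / (D + 1)).
    by rewrite lt_min !divr_gt0//; lra.
  near (0 : R)^'+ => h; exists h.
  have h0 : 0 < h by near: h; exact: nbhs_right_gt.
  have : h < Num.min (M / 2) (d / 4 / (D + 1)) by near: h; exact: nbhs_right_lt.
  rewrite lt_min => /andP[hM]; rewrite ltr_pdivlMr; last by lra.
  move=> hd; split => //; first by lra.
    by move: hd; rewrite mulrDr; lra.
  by near: h; exact: outer.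
have [Y [Y0 YD YLD Yl]] : exists Y, [/\ 0 < Y, D / Y <= d, L / Y ^+ 2 * D <= d / 2 &
    \forall n \near \oo, forall y, Y <= y <= 2 * Y -> `|u n (e n * y) - l| <= d].
  near (pinfty_nbhs R) => Y; exists Y.
  have Y1 : 1 <= Y by near: Y; apply: nbhs_pinfty_ge; rewrite num_real.
  have YD : D / d <= Y by near: Y; apply: nbhs_pinfty_ge; rewrite num_real.
  have YL : L * D / (d / 2) <= Y by near: Y; apply: nbhs_pinfty_ge; rewrite num_real.
  have Y0 : 0 < Y by lra.
  split => //.
  - by rewrite ler_pdivrMr// mulrC -ler_pdivrMr.
  - rewrite mulrAC ler_pdivrMr ?exprn_gt0//.
    move: YL; rewrite ler_pdivrMr ?divr_gt0// => /le_trans; apply.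
    by rewrite [leRHS]mulrC ler_pM2r ?divr_gt0// expr2 ler_peMr// ltW.
  - by near: Y; exact: inner.
have [n [nD nY rn ln]] : exists n, [/\ e n * D <= d * h, e n * (2 * Y) <= h,
    (forall x, h <= x <= 2 * h -> `|u n x - r| <= d) &
    forall y, Y <= y <= 2 * Y -> `|u n (e n * y) - l| <= d].
  have small k : 0 < k -> \forall n \near \oo, e n <= k.
    move=> k0; have /cvgrPdist_le/(_ _ k0) := ecvg.
    by apply: filterS => n; rewrite sub0r normrN gtr0_norm.
  near \oo => n; exists n; split.
  - have : e n <= d * h / (D + 1).
      by near: n; apply: small; rewrite divr_gt0 ?mulr_gt0//; lra.
    by rewrite ler_pdivlMr ?mulrDr; last lra; have := e0 n; lra.
  - rewrite -ler_pdivlMr; last by lra.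
    by near: n; apply: small; rewrite divr_gt0//; lra.
  - by near: n.
  - by near: n.
have [a [b [[aY bh ab] [pa pb G]]]] := wave_transition M0 (e0 n) LR cgm cgp (W n)
  fpd gL h0 hM hD Y0 YD YLD nD nY.
have en0 := e0 n; have eY0 : 0 < e n * Y by rewrite mulr_gt0.
have abM c : a <= c <= b -> - M < c < M.
  by move: M0 hM eY0 aY bh; clear; lra.
exists (u n), (fun x => e n * p n x), a, b; split; split=> //.
- exact: ltW.
- apply: continuous_subspaceW (wave_contu (W n)) => c /=.
  by rewrite !in_itv /= => /abM/andP[? ?]; rewrite !ltW.
- by apply: (wave_nondecreasing M0 LR cgm cgp (W n)); exact: ltW.
- have -> : a = e n * (a / e n) by rewrite mulrC divfK// gt_eqF.
  by apply: ln; rewrite ler_pdivlMr// ler_pdivrMr//; move: aY; clear; lra.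
- by apply: rn; case/andP: bh => hb bh; rewrite !ltW.
- move=> c /abM cM; apply: mulr_ge0 (ltW en0) _.
  exact: (wave_p_ge0 M0 LR cgm cgp (W n) cM).
Unshelve. all: by end_near. Qed.

(** * Traces of L1loc limits of monotone functions *)

(** If |F n - f| >= d on all of [a, b], its integral there is at least
    d (b - a). *)
Lemma cvg_L1loc_near (R : realType) (F : nat -> R -> R) (f : R -> R)
    (a b d : R) :
  cvg_L1loc F f -> a < b -> 0 < d ->
  \forall n \near \oo, exists2 x, a <= x <= b & `|F n x - f x| < d.
Proof.
case=> lF [mf _ _] cF ab d0.
pose K := [set` `[a, b]].
have mK : measurable K by exact: measurable_itv.
have dK : (0 < (d * (b - a))%:E)%E by rewrite lte_fin mulr_gt0// subr_gt0.
have := cF _ (@segment_compact R a b).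
move=> /fine_cvgP[fin /cvgrPdist_lt/(_ (d * (b - a)))].
rewrite mulr_gt0 ?subr_gt0// => /(_ isT) near_lt.
near=> n; apply: contrapT => /forall2NP nofar.
have : `|0 - fine (\int[lebesgue_measure]_(x in K) `|F n x - f x|%:E)%E| < d * (b - a).
  by near: n.
rewrite sub0r normrN; apply/negP; rewrite -leNgt.
apply: le_trans (ler_norm _).
rewrite -lee_fin fineK; last by near: n.
have -> : ((d * (b - a))%:E = \int[lebesgue_measure]_(x in K) d%:E)%E.
  rewrite integral_cst//= /K lebesgue_measure_itv/= lte_fin ab.
  by rewrite -EFinB -EFinM.
have [mFn _ _] := lF n.
apply: ge0_le_integral => //.
- by move=> x _; rewrite lee_fin ltW.
- apply/measurable_EFinP; apply: measurable_funS (subsetT _) _ => //.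
  apply: measurableT_comp => //; exact: measurable_funB.
- move=> x; rewrite /K /= in_itv /= => xab; rewrite lee_fin leNgt.
  by have [/(_ xab)|/negP] := nofar x.
Unshelve. all: by end_near. Qed.

(** There are points of [a, c] and of [c', b] where F n is close to f;
    monotonicity transports the bounds they give to all of [c, c']. *)
Lemma cvg_L1loc_monotone (R : realType) (F : nat -> R -> R) (f : R -> R)
    (l d a b c c' : R) :
  cvg_L1loc F f -> (forall n, monotone_fun (F n)) -> 0 < d ->
  (forall x, a <= x <= b -> `|f x - l| <= d) -> a < c -> c < c' -> c' < b ->
  \forall n \near \oo, forall x, c <= x <= c' -> `|F n x - l| <= 2 * d.
Proof.
move=> cF mF d0 fl ac cc' c'b; near=> n => x xc.
have [y yac Fy] : exists2 y, a <= y <= c & `|F n y - f y| < d.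
  by near: n; exact: cvg_L1loc_near.
have [z zcb Fz] : exists2 z, c' <= z <= b & `|F n z - f z| < d.
  by near: n; exact: cvg_L1loc_near.
have : a <= y <= b by lra.
have : a <= z <= b by lra.
move=> /fl + /fl; have yx : y <= x by lra.
have xz : x <= z by lra.
move: Fy Fz; rewrite !ltr_norml !ler_norml.
by case: (mF n) => h; have := h _ _ yx; have := h _ _ xz; lra.
Unshelve. all: by end_near. Qed.

Lemma cvg_L1loc_right_trace (R : realType) (F : nat -> R -> R) (f : R -> R)
    (l : R) :
  cvg_L1loc F f -> (forall n, monotone_fun (F n)) ->
  f x @[x --> 0^'+] --> l -> forall d : R, 0 < d ->
  \forall h \near (0 : R)^'+, \forall n \near \oo,
    forall x, h <= x <= 2 * h -> `|F n x - l| <= d.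
Proof.
move=> cF mF fl d d0; have d20 : 0 < d / 2 by lra.
have /cvgrPdist_le/(_ _ d20) := fl.
move=> [k /= k0 fk]; near=> h.
have h0 : 0 < h by near: h; exact: nbhs_right_gt.
have hk : h < k / 3 by near: h; apply: nbhs_right_lt; rewrite divr_gt0.
have fh x : h / 2 <= x <= 3 * h -> `|f x - l| <= d / 2.
  move=> xh; rewrite distrC; apply: fk; last by lra.
  by rewrite /ball_ /= sub0r normrN gtr0_norm; lra.
have := cvg_L1loc_monotone cF mF d20 fh (c := h) (c' := 2 * h).
by rewrite (_ : 2 * (d / 2) = d); [apply; lra|lra].
Unshelve. all: by end_near. Qed.

Lemma cvg_L1loc_left_trace (R : realType) (F : nat -> R -> R) (f : R -> R)
    (l : R) :
  cvg_L1loc F f -> (forall n, monotone_fun (F n)) ->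
  f x @[x --> 0^'-] --> l -> forall d : R, 0 < d ->
  \forall h \near (0 : R)^'+, \forall n \near \oo,
    forall x, h <= x <= 2 * h -> `|F n (- x) - l| <= d.
Proof.
move=> cF mF fl d d0; have d20 : 0 < d / 2 by lra.
have /cvgrPdist_le/(_ _ d20) := fl.
move=> [k /= k0 fk]; near=> h.
have h0 : 0 < h by near: h; exact: nbhs_right_gt.
have hk : h < k / 3 by near: h; apply: nbhs_right_lt; rewrite divr_gt0.
have fh x : - (3 * h) <= x <= - (h / 2) -> `|f x - l| <= d / 2.
  move=> xh; rewrite distrC; apply: fk; last by lra.
  by rewrite /ball_ /= sub0r normrN ltr0_norm; lra.
have := cvg_L1loc_monotone cF mF d20 fh (c := - (2 * h)) (c' := - h).
rewrite (_ : 2 * (d / 2) = d); last by lra.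
move=> H; have : \forall n \near \oo, forall x, - (2 * h) <= x <= - h -> `|F n x - l| <= d.
  by apply: H; lra.
by apply: filterS => n H' x xh; apply: H'; lra.
Unshelve. all: by end_near. Qed.

Lemma cvg_L1loc_pinfty (R : realType) (F : nat -> R -> R) (f : R -> R)
    (l : R) :
  cvg_L1loc F f -> (forall n, monotone_fun (F n)) ->
  f x @[x --> +oo] --> l -> forall d : R, 0 < d ->
  \forall Y \near +oo, \forall n \near \oo,
    forall y, Y <= y <= 2 * Y -> `|F n y - l| <= d.
Proof.
move=> cF mF fl d d0; have d20 : 0 < d / 2 by lra.
have /cvgrPdist_le/(_ _ d20) := fl.
move=> [k /= [_ fk]]; near=> Y.
have Y0 : 1 <= Y by near: Y; apply: nbhs_pinfty_ge; rewrite num_real.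
have kY : k + 2 <= Y by near: Y; apply: nbhs_pinfty_ge; rewrite num_real.
have fY x : Y - 1 <= x <= 2 * Y + 1 -> `|f x - l| <= d / 2.
  by move=> xh; rewrite distrC; apply: fk; lra.
have := cvg_L1loc_monotone cF mF d20 fY (c := Y) (c' := 2 * Y).
by rewrite (_ : 2 * (d / 2) = d); [apply; lra|lra].
Unshelve. all: by end_near. Qed.

Lemma cvg_L1loc_ninfty (R : realType) (F : nat -> R -> R) (f : R -> R)
    (l : R) :
  cvg_L1loc F f -> (forall n, monotone_fun (F n)) ->
  f x @[x --> -oo] --> l -> forall d : R, 0 < d ->
  \forall Y \near +oo, \forall n \near \oo,
    forall y, Y <= y <= 2 * Y -> `|F n (- y) - l| <= d.
Proof.
move=> cF mF fl d d0; have d20 : 0 < d / 2 by lra.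
have /cvgrPdist_le/(_ _ d20) := fl.
move=> [k /= [_ fk]]; near=> Y.
have Y0 : 1 <= Y by near: Y; apply: nbhs_pinfty_ge; rewrite num_real.
have kY : - k + 2 <= Y by near: Y; apply: nbhs_pinfty_ge; rewrite num_real.
have fY x : - (2 * Y + 1) <= x <= - (Y - 1) -> `|f x - l| <= d / 2.
  by move=> xh; rewrite distrC; apply: fk; lra.
have := cvg_L1loc_monotone cF mF d20 fY (c := - (2 * Y)) (c' := - Y).
rewrite (_ : 2 * (d / 2) = d); last by lra.
move=> H; have : \forall n \near \oo, forall x, - (2 * Y) <= x <= - Y -> `|F n x - l| <= d.
  by apply: H; lra.
by apply: filterS => n H' y yY; apply: H'; lra.
Unshelve. all: by end_near. Qed.

(** * Limits of the inner profile *)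

(** If c is nonnegative near +oo, then (P^2)' = 2 c P^2 makes |P| nondecreasing
    there, so U grows at least linearly. *)
Lemma bounded_profile_speed (R : realType) (U P c : R -> R) (B ci : R) :
  (forall y : R, is_derive y 1 U (P y)) ->
  (forall y : R, is_derive y 1 P (c y * P y)) -> (forall y, P y != 0) ->
  (forall y, `|U y| <= B) -> c y @[y --> +oo] --> ci -> ci <= 0.
Proof.
move=> Ud Pd P0 UB cc; rewrite leNgt; apply/negP => ci0.
have /cvgrPdist_le/(_ _ ci0)[A [_ cA]] := cc.
have c0 y : A + 1 <= y -> 0 <= c y.
  move=> Ay; have : `|ci - c y| <= ci by apply: cA; lra.
  by rewrite ler_norml; lra.
have Pinc y : A + 1 <= y -> `|P (A + 1)| <= `|P y|.
  move=> Ay; rewrite -ler_sqr ?nnegrE// !real_normK ?num_real//.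
  apply: (@derive_ge0_le _ (fun z => P z ^+ 2)
    (fun z => 2 * c z * (P z * P z))) => // z zA.
    apply: is_derive_eq (is_derive_mulfun (Pd z) (Pd z)) _; ring.
  apply: mulr_ge0; last by rewrite -expr2 sqr_ge0.
  by apply: mulr_ge0 => //; apply: c0; lra.
pose m := `|P (A + 1)|; have m0 : 0 < m by rewrite normr_gt0.
have B0 : 0 <= B by apply: le_trans (UB 0).
(* At distance (2 B + 1) / m the increment of U exceeds the 2 B allowed by its bound. *)
pose y := A + 1 + (2 * B + 1) / m.
have Ay : A + 1 < y by rewrite ltrDl divr_gt0//; lra.
have [z /andP[Az zy] UE] := derive_mean_value Ay (fun x _ => Ud x).
have : 2 * B + 1 <= `|U y - U (A + 1)|.
  rewrite UE normrM (gtr0_norm (x := y - _)) ?subr_gt0//.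
  rewrite -ler_pdivrMr ?subr_gt0// (_ : y - (A + 1) = (2 * B + 1) / m); last first.
    by rewrite /y; ring.
  rewrite invf_div mulrC divfK; last by lra.
  by apply: Pinc; exact: ltW.
have := ler_normB (U y) (U (A + 1)); have := UB y; have := UB (A + 1); lra.
Qed.

(** Relating the integrand to the standard normal density turns the inner colour
    into a cumulative distribution function. *)
Lemma Rintegral_gauss (R : realType) (D : set R) : measurable D ->
  \int[lebesgue_measure]_(s in D) expR (- (s ^+ 2 / 2)) =
  fine (normal_prob 0 (1 : R) D) / normal_peak (1 : R).
Proof.
move=> mD; have k0 : 0 < normal_peak (1 : R) by apply: normal_peak_gt0; rewrite oner_eq0.
have ipdf : lebesgue_measure.-integrable D (EFin \o normal_pdf 0 (1 : R)).
  by apply: integrableS (integrable_normal_pdf _ _).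
rewrite mulrC -[fine _]/(\int[lebesgue_measure]_(x in D) normal_pdf 0 (1 : R) x).
rewrite -RintegralZl//; apply: eq_Rintegral => x _.
rewrite normal_pdfE ?oner_eq0// mulKf ?gt_eqF//.
by rewrite /normal_fun subr0 expr1n mulNr.
Qed.

Lemma inner_colorE (R : realType) (y : R) :
  inner_color y = -1 + 2 * fine (normal_prob 0 (1 : R) `]-oo, y]).
Proof.
have k0 : 0 < normal_peak (1 : R) by apply: normal_peak_gt0; rewrite oner_eq0.
rewrite /inner_color !Rintegral_gauss//.
rewrite [in X in _ / X](@probability_setT _ _ R (normal_prob 0 1)) /=.
by congr (-1 + 2 * _); field; rewrite gt_eqF.
Qed.

Lemma inner_color_cvg (R : realType) :
  inner_color y @[y --> +oo] --> (1 : R) /\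
  inner_color y @[y --> -oo] --> (-1 : R).
Proof.
pose P : probability _ R := normal_prob 0 (1 : R).
have mid : measurable_fun setT (idfun : measurableTypeR R -> R).
  by move=> _ Y mY; rewrite setTI.
(* The identity, whose law is the standard normal law. *)
pose X : {RV P >-> R} :=
  HB.pack (idfun : R -> R) (isMeasurableFun.Build _ _ (measurableTypeR R) R idfun mid).
have E : inner_color = (fun y : R => -1 + 2 * fine (cdf X y)).
  by apply/funext => y; rewrite inner_colorE.
rewrite E; split.
- rewrite [X in _ --> X](_ : 1 = -1 + 2 * 1 :> R); last by ring.
  apply: cvgD; first exact: cvg_cst.
  apply: cvgM; first exact: cvg_cst.
  exact: fine_cvg (cvg_cdfy1 X).
- rewrite [X in _ --> X](_ : -1 = -1 + 2 * 0 :> R); last by ring.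
  apply: cvgD; first exact: cvg_cst.
  apply: cvgM; first exact: cvg_cst.
  exact: fine_cvg (cvg_cdfNy0 X).
Qed.

(** * Relations at the traces *)

(** The constant c is kept general because c > 0 is what yields strict signs for
    a genuinely nonlinear flux. *)
Lemma right_slope_le (R : realType) (f : R -> R) (x a c k : R) :
  0 < k -> is_derive x 1 f a ->
  (forall h, 0 < h < k -> c * h <= f (x + h) - f x) -> c <= a.
Proof.
move=> k0 fa fc; have [df <-] := fa.
have cq : h^-1 *: (f (h *: 1 + x) - f x) @[h --> 0^'+] --> 'D_1 f x.
  exact: cvg_dnbhs_at_right df.
apply: (cvgr_to_ge cq); near=> h.
have h0 : 0 < h by near: h; exact: nbhs_right_gt.
rewrite -(ler_pM2r h0) /GRing.scale /= mulrAC mulVf ?gt_eqF// mul1r mulr1 (addrC h).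
apply: fc; rewrite h0 /=; near: h; exact: nbhs_right_lt.
Unshelve. all: by end_near. Qed.

(** The flux part of the conclusion at one trace, with g in the role of the
    derivative of f, l of the inner endpoint and r of the outer trace. *)
Definition trace_relation (R : realType) (f g : R -> R) (l r : R) : Prop :=
  [/\ f l = f r,
      forall k, hull2 l r k ->
        Num.sg (r - k) * (f r - f k) <= 0 /\ 0 <= Num.sg (l - k) * (f l - f k) &
      l != r -> [/\ 0 <= g l, g r <= 0 &
        genuinely_nonlinear f -> 0 < g l /\ g r < 0]].

Lemma strictly_convex_comp_opp (R : realType) (f : R -> R) :
  strictly_convex_on setT f -> strictly_convex_on setT (fun x => f (- x)).
Proof.
move=> cf x y t _ _ xy t01; rewrite opprD -!mulrN.
by apply: cf => //; rewrite eqr_opp.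
Qed.

Lemma genuinely_nonlinear_opp (R : realType) (f : R -> R) :
  genuinely_nonlinear f -> genuinely_nonlinear (fun x => - f x).
Proof.
move=> [cf|cf]; [right|by left].
by rewrite /strictly_concave_on; under eq_fun do rewrite opprK.
Qed.

Lemma genuinely_nonlinear_comp_opp (R : realType) (f : R -> R) :
  genuinely_nonlinear f -> genuinely_nonlinear (fun x => f (- x)).
Proof.
by move=> [cf|cf]; [left|right]; exact: (strictly_convex_comp_opp cf).
Qed.

(** The symmetry w -> - w, f -> - f(- .), under which the products of the entropy
    inequalities and the derivatives of the flux are invariant. *)
Lemma trace_relation_opp (R : realType) (f g : R -> R) (l r : R) :
  trace_relation (fun w => - f (- w)) (fun w => g (- w)) (- l) (- r) ->
  trace_relation f g l r.
Proof.
rewrite /trace_relation !opprK eqr_opp => -[flr sgk nt]; split.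
- exact: oppr_inj.
- move=> k klr; have : hull2 (- l) (- r) (- k).
    move: klr; rewrite /hull2 /= !in_itv /= -oppr_max -oppr_min !lerN2.
    by rewrite andbC.
  have N (a b : R) : - a + b = - (a - b) by ring.
  by move=> /sgk; rewrite !opprK !N !sgrN !mulrNN.
- move=> /nt[gl gr gn]; split=> // nf; apply: gn.
  by apply: genuinely_nonlinear_opp; exact: genuinely_nonlinear_comp_opp.
Qed.

Lemma left_slope_le (R : realType) (f : R -> R) (x a c k : R) :
  0 < k -> is_derive x 1 f a ->
  (forall h, 0 < h < k -> c * h <= f (x - h) - f x) -> a <= - c.
Proof.
move=> k0 fa fc; rewrite -lerN2 opprK.
have fN : is_derive (- x) 1 (fun z => f (- z)) (- a).
  by apply: is_derive_comp_opp; rewrite opprK.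
apply: (right_slope_le k0 fN) => h /fc.
by rewrite opprD !opprK.
Qed.

Lemma strictly_concave_chord (R : realType) (f : R -> R) (x m t : R) :
  strictly_concave_on setT f -> x != m -> 0 < t < 1 ->
  t * (f m - f x) <= f (x + t * (m - x)) - f x.
Proof.
move=> cf xm t01; have := cf m x t Logic.I Logic.I; rewrite eq_sym => /(_ xm t01).
have -> : x + t * (m - x) = t * m + (1 - t) * x by ring.
lra.
Qed.

(** On [l, r] the flux is minimal at both ends, which gives the weak signs. A
    strictly convex flux would be smaller at the midpoint m. A strictly
    concave one lies above its chords to m, whose slopes bound the derivatives
    away from 0. *)
Lemma viscous_layer_trace (R : realType) (f g : R -> R) (l r : R) :
  (forall w : R, is_derive w 1 f (g w)) -> viscous_layer f l r ->
  l <= r /\ trace_relation f g l r.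
Proof.
move=> fd lay.
have cf : continuous f.
  by move=> w; have [/derivable1_diffP/differentiable_continuous] := fd w.
have [lr flr fk] := viscous_layer_flux cf lay.
split=> //; split=> //.
  move=> k; rewrite /hull2 /= in_itv /= (min_l lr) (max_r lr) => /andP[lk kr].
  have := fk k; rewrite lk kr -flr => /(_ isT) fkl.
  split.
    by rewrite mulr_ge0_le0 ?sgr_ge0 ?subr_ge0// subr_le0.
  by rewrite mulr_le0 ?sgr_le0 ?subr_le0.
move=> nlr; have ltlr : l < r by rewrite lt_neqAle nlr.
have rl0 : 0 < r - l by rewrite subr_gt0.
split.
- apply: (right_slope_le rl0 (fd l)) => h hk.
  by rewrite mul0r subr_ge0 fk//; lra.
- rewrite -oppr0; apply: (left_slope_le rl0 (fd r)) => h hk.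
  by rewrite mul0r subr_ge0 -flr fk//; lra.
- have half : 0 < (2^-1 : R) < 1 by lra.
  pose m := 2^-1 * l + (1 - 2^-1) * r.
  have lm : l < m by rewrite /m; lra.
  have mr : m < r by rewrite /m; lra.
  case=> cvx.
    have := cvx l r 2^-1 Logic.I Logic.I nlr half; rewrite -/m.
    have /fk : l <= m <= r by lra.
    lra.
  have fm : f l < f m.
    by have := cvx l r 2^-1 Logic.I Logic.I nlr half; rewrite -/m -flr; lra.
  split.
    have ml0 : 0 < m - l by lra.
    apply: (@lt_le_trans _ _ ((f m - f l) / (m - l))).
      by rewrite divr_gt0// subr_gt0.
    apply: (right_slope_le ml0 (fd l)) => h /andP[h0 hml].
    have t01 : 0 < h / (m - l) < 1 by rewrite divr_gt0// ltr_pdivrMr// mul1r.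
    have := strictly_concave_chord cvx (negbT (lt_eqF lm)) t01; rewrite divfK ?gt_eqF//.
    by have -> : (f m - f l) / (m - l) * h = h / (m - l) * (f m - f l) by ring.
  have rm0 : 0 < r - m by lra.
  apply: (@le_lt_trans _ _ (- ((f m - f r) / (r - m)))); last first.
    by rewrite oppr_lt0 divr_gt0// subr_gt0 -flr.
  apply: (left_slope_le rm0 (fd r)) => h /andP[h0 hrm].
  have t01 : 0 < h / (r - m) < 1 by rewrite divr_gt0// ltr_pdivrMr// mul1r.
  have := strictly_concave_chord cvx (negbT (gt_eqF mr)) t01.
  rewrite -[m - r]opprB mulrN divfK ?gt_eqF//.
  by have -> : (f m - f r) / (r - m) * h = h / (r - m) * (f m - f r) by ring.
Qed.

(** * Traces of viscous limits *)

Lemma derivable_derive1 (R : realType) (f : R -> R) (x : R) :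
  derivable f x 1 -> is_derive x 1 f (derive1 f x).
Proof. by move=> fx; rewrite derive1E; exact: derivableP. Qed.

Lemma dafermos_coupled_wave (R : realType) (fm fp : R -> R) (uL uR M e : R)
    (u v : R -> R) : 0 < e -> dafermos_solution fm fp uL uR M e u v ->
  coupled_wave (derive1 fm) (derive1 fp) uL uR M e
    u (derive1 u) v (derive1 v).
Proof.
move=> e0 [[cu cv] ud vd lft rgt]; split=> //.
- by move=> x /ud[d _ _]; exact: derivable_derive1.
- move=> x /ud[_ /derivable_derive1 d eqn]; apply: is_derive_eq d _.
  have en : e != 0 by rewrite gt_eqF.
  by apply: (mulfI en); rewrite -eqn /coupled_speed; field.
- by move=> x /vd[d _ _]; exact: derivable_derive1.
- move=> x /vd[_ /derivable_derive1 d eqn]; apply: is_derive_eq d _.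
  have e20 : e ^+ 2 != 0 by rewrite sqrf_eq0 gt_eqF.
  by apply: (mulfI e20); rewrite -eqn; field; rewrite gt_eqF.
Qed.

Lemma continuous_comp_opp (R : realType) (g : R -> R) :
  continuous g -> continuous (fun w => g (- w)).
Proof. by move=> cg w; apply: continuous_comp; [exact: opp_continuous|exact: cg]. Qed.

Lemma wave_monotone (R : realType) (gm gp : R -> R) (uL uR M e : R)
    (u p v q : R -> R) :
  0 < M -> continuous gm -> continuous gp ->
  coupled_wave gm gp uL uR M e u p v q -> monotone_fun u.
Proof.
move=> M0 cgm cgp W; have [LR|RL] := leP uL uR; [left|right].
  exact: (wave_nondecreasing M0 LR cgm cgp W).
have LR : - uL <= - uR by rewrite lerN2 ltW.
move=> x y xy; rewrite -lerN2.
by apply: (wave_nondecreasing M0 LR _ _ (coupled_wave_opp W)) xy; exact: continuous_comp_opp.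
Qed.

Lemma wave_right_trace (R : realType) (gm gp fp : R -> R) (uL uR M l r : R)
    (e : nat -> R) (u p v q : nat -> R -> R) :
  0 < M -> continuous gm -> continuous gp ->
  (forall w : R, is_derive w 1 fp (gp w)) ->
  (forall n, 0 < e n) -> e n @[n --> \oo] --> 0 ->
  (forall n, coupled_wave gm gp uL uR M (e n) (u n) (p n) (v n) (q n)) ->
  (forall d : R, 0 < d -> \forall h \near (0 : R)^'+, \forall n \near \oo,
    forall x, h <= x <= 2 * h -> `|u n x - r| <= d) ->
  (forall d : R, 0 < d -> \forall Y \near +oo, \forall n \near \oo,
    forall y, Y <= y <= 2 * Y -> `|u n (e n * y) - l| <= d) ->
  0 <= (uR - uL) * (r - l) /\ trace_relation fp gp l r.
Proof.
move=> M0 cgm cgp fpd e0 ecvg W outer inner.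
have [LR|RL] := leP uL uR.
  have lay := wave_viscous_layer M0 LR cgm cgp fpd e0 ecvg W outer inner.
  have [lr tr] := viscous_layer_trace fpd lay.
  by split=> //; rewrite mulr_ge0// subr_ge0.
have LR : - uL <= - uR by rewrite lerN2 ltW.
have fpd' (w : R) : is_derive w 1 (fun w => - fp (- w)) (gp (- w)).
  apply: is_derive_eq (is_deriveN (is_derive_comp_opp (fpd (- w)))) _.
  by rewrite opprK.
have dist a b : `|- a - - b| = `|a - b| :> R by rewrite -opprD normrN.
have lay : viscous_layer (fun w => - fp (- w)) (- l) (- r).
  apply: (wave_viscous_layer M0 LR (continuous_comp_opp cgm)
    (continuous_comp_opp cgp) fpd' e0 ecvg (fun n => coupled_wave_opp (W n))).
  - move=> d /outer; apply: filterS => h; apply: filterS => n H x xh.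
    by rewrite dist; exact: H.
  - move=> d /inner; apply: filterS => h; apply: filterS => n H x xh.
    by rewrite dist; exact: H.
have [lr tr] := viscous_layer_trace fpd' lay; split.
  by rewrite mulr_le0 ?subr_le0 ?(ltW RL)// -lerN2.
exact: trace_relation_opp tr.
Qed.

(** The reflection x -> - x exchanges the two sides and makes - fm the flux on
    the right. *)
Lemma wave_left_trace (R : realType) (gm gp fm : R -> R) (uL uR M l r : R)
    (e : nat -> R) (u p v q : nat -> R -> R) :
  0 < M -> continuous gm -> continuous gp ->
  (forall w : R, is_derive w 1 fm (gm w)) ->
  (forall n, 0 < e n) -> e n @[n --> \oo] --> 0 ->
  (forall n, coupled_wave gm gp uL uR M (e n) (u n) (p n) (v n) (q n)) ->
  (forall d : R, 0 < d -> \forall h \near (0 : R)^'+, \forall n \near \oo,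
    forall x, h <= x <= 2 * h -> `|u n (- x) - l| <= d) ->
  (forall d : R, 0 < d -> \forall Y \near +oo, \forall n \near \oo,
    forall y, Y <= y <= 2 * Y -> `|u n (e n * - y) - r| <= d) ->
  0 <= (uR - uL) * (r - l) /\
  trace_relation (fun w => - fm w) (fun w => - gm w) r l.
Proof.
move=> M0 cgm cgp fmd e0 ecvg W outer inner.
have cN g : continuous g -> continuous (fun w : R => - g w : R).
  by move=> cg w; apply: cvgN; exact: cg.
have fmd' (w : R) : is_derive w 1 (fun w => - fm w) (- gm w).
  exact: is_deriveN.
have [||tr1 tr2] := wave_right_trace M0 (cN _ cgp) (cN _ cgm) fmd' e0 ecvg
  (fun n => coupled_wave_refl M0 (e0 n) (W n)) (l := r) (r := l).
- exact: outer.
- move=> d /inner; apply: filterS => Y; apply: filterS => n H y yY.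
  by rewrite -mulrN; exact: H.
- by split=> //; move: tr1; rewrite -[uL - _]opprB -[l - _]opprB mulrNN.
Qed.

(** This quadratic form says that r - l lies between 0 and uR - uL whatever the
    sign of the latter, and it gives the strict sign of (uR - uL) (r - l) as
    soon as r and l differ. *)
Lemma wave_inner_range (R : realType) (gm gp : R -> R) (uL uR M l r : R)
    (e : nat -> R) (u p v q : nat -> R -> R) :
  0 < M -> continuous gm -> continuous gp -> (forall n, 0 < e n) ->
  (forall n, coupled_wave gm gp uL uR M (e n) (u n) (p n) (v n) (q n)) ->
  (forall d : R, 0 < d -> \forall Y \near +oo, \forall n \near \oo,
    forall y, Y <= y <= 2 * Y -> `|u n (e n * y) - r| <= d) ->
  (forall d : R, 0 < d -> \forall Y \near +oo, \forall n \near \oo,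
    forall y, Y <= y <= 2 * Y -> `|u n (e n * - y) - l| <= d) ->
  (r - l) ^+ 2 <= (uR - uL) * (r - l).
Proof.
move=> M0 cgm cgp e0 W right left.
have approx d : 0 < d -> exists n y, [/\ 0 < y, `|u n (e n * y) - r| <= d &
    `|u n (e n * - y) - l| <= d].
  move=> d0; near (pinfty_nbhs R) => Y; near \oo => n; exists n, Y.
  have Y0 : 0 < Y by near: Y; apply: nbhs_pinfty_gt; rewrite num_real.
  have Y2 : Y <= Y <= 2 * Y by lra.
  split=> //.
    suff : forall y, Y <= y <= 2 * Y -> `|u n (e n * y) - r| <= d by exact.
    by near: n; near: Y; exact: right.
  suff : forall y, Y <= y <= 2 * Y -> `|u n (e n * - y) - l| <= d by exact.
  by near: n; near: Y; exact: left.
have [LR|RL] := leP uL uR.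
  suff : 0 <= r - l <= uR - uL by move=> /andP[a b]; rewrite expr2 ler_wpM2r.
  suff H d : 0 < d -> - d <= r - l <= (uR - uL) + d.
    apply/andP; split; apply/ler_addgt0Pr => d /H; lra.
  move=> d0; have d20 : 0 < d / 2 by lra.
  have [n [y [y0]]] := approx _ d20.
  have := wave_bound M0 LR cgm cgp (W n) (e n * y).
  have := wave_bound M0 LR cgm cgp (W n) (e n * - y).
  have yy : e n * - y <= e n * y by rewrite ler_pM2l//; lra.
  have := wave_nondecreasing M0 LR cgm cgp (W n) yy.
  by rewrite !ler_norml; lra.
have LR : - uL <= - uR by rewrite lerN2 ltW.
suff : 0 <= l - r <= uL - uR.
  move=> /andP[a b]; rewrite -[r - l]opprB -[uR - uL]opprB sqrrN mulrNN.
  by rewrite expr2 ler_wpM2r.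
suff H d : 0 < d -> - d <= l - r <= (uL - uR) + d.
  apply/andP; split; apply/ler_addgt0Pr => d /H; lra.
move=> d0; have d20 : 0 < d / 2 by lra.
have [n [y [y0]]] := approx _ d20.
have cgm' := continuous_comp_opp cgm; have cgp' := continuous_comp_opp cgp.
have := wave_bound M0 LR cgm' cgp' (coupled_wave_opp (W n)) (e n * y).
have := wave_bound M0 LR cgm' cgp' (coupled_wave_opp (W n)) (e n * - y).
have yy : e n * - y <= e n * y by rewrite ler_pM2l//; lra.
have := wave_nondecreasing M0 LR cgm' cgp' (coupled_wave_opp (W n)) yy.
by rewrite !ler_norml; lra.
Unshelve. all: by end_near. Qed.

(** * Nontrivial inner profiles and conclusion *)

Lemma monotone_fun_limits (R : realType) (U : R -> R) (l r : R) :
  monotone_fun U -> U y @[y --> -oo] --> l -> U y @[y --> +oo] --> r ->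
  forall y, Num.min l r <= U y <= Num.max l r.
Proof.
move=> mU Ul Ur y; rewrite ge_min le_max.
have lo a : \forall z \near -oo, z <= a :> R by apply: nbhs_ninfty_le; rewrite num_real.
have hi a : \forall z \near +oo, a <= z :> R by apply: nbhs_pinfty_ge; rewrite num_real.
case: mU => mU.
  have -> : l <= U y by apply: (cvgr_to_le Ul); apply: filterS (lo y) => z; exact: mU.
  have -> : U y <= r by apply: (cvgr_to_ge Ur); apply: filterS (hi y) => z; exact: mU.
  by rewrite orbT.
have -> : U y <= l by apply: (cvgr_to_ge Ul); apply: filterS (lo y) => z; exact: mU.
have -> : r <= U y by apply: (cvgr_to_le Ur); apply: filterS (hi y) => z; exact: mU.
by rewrite orbT.
Qed.

(** The statement at -oo is the one at +oo for the reflected profile y -> U(- y),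
    whose speed is - c(- y). *)
Lemma nontrivial_inner_endpoints (R : realType) (fm fp U : R -> R) (Um Up : R) :
  continuous (derive1 fm) -> continuous (derive1 fp) ->
  inner_profile fm fp U -> nontrivial_inner U ->
  U y @[y --> -oo] --> Um -> U y @[y --> +oo] --> Up ->
  [/\ Um != Up, 0 <= derive1 fm Um & derive1 fp Up <= 0].
Proof.
move=> cgm cgp [[U1 [U2 _]] _ mU ode] nt Ul Ur.
have Ud (y : R) : is_derive y 1 U (derive1 U y) by exact: derivable_derive1.
pose c y := coupled_speed fm fp (inner_color y) (U y).
have Pd (y : R) : is_derive y 1 (derive1 U) (c y * derive1 U y).
  by rewrite /c ode; exact: derivable_derive1.
have Ulr := monotone_fun_limits mU Ul Ur.
have UB y : `|U y| <= `|Um| + `|Up|.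
  have := ler_norm Um; have := ler_norm (- Um); rewrite normrN.
  have := ler_norm Up; have := ler_norm (- Up); rewrite normrN.
  by have := Ulr y; rewrite ler_norml; case: (leP Um Up) => _; lra.
have [c1 cN1] := inner_color_cvg R.
split.
- apply/eqP => eqU; have [x _] := derive_mean_value ltr01 (fun x _ => Ud x).
  have Uc y : U y = Up.
    by apply/eqP; rewrite eq_le; have := Ulr y; rewrite eqU minxx maxxx andbC.
  by rewrite !Uc subrr subr0 mulr1 => /esym/eqP; apply/negP; exact: nt.
- have cl : c y @[y --> -oo] --> derive1 fm Um.
    rewrite (_ : derive1 fm Um = coupled_speed fm fp (-1) Um); last first.
      by rewrite /coupled_speed; field.
    apply: cvgM; first exact: cvg_cst.
    apply: cvgD; (apply: cvgM; last (apply: cvg_comp; first exact: Ul)).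
    + by apply: cvgB; [exact: cvg_cst|exact: cN1].
    + exact: cgm.
    + by apply: cvgD; [exact: cvg_cst|exact: cN1].
    + exact: cgp.
  rewrite -oppr_le0.
  apply: (@bounded_profile_speed _ (fun y => U (- y))
    (fun y => - derive1 U (- y)) (fun y => - c (- y)) (`|Um| + `|Up|)).
  + by move=> y; exact: is_derive_comp_opp.
  + move=> y; apply: is_derive_eq (is_deriveN (is_derive_comp_opp (Pd (- y)))) _.
    by rewrite opprK mulrNN.
  + by move=> y; rewrite oppr_eq0; exact: nt.
  + by move=> y; exact: UB.
  + by apply: cvgN; move/cvgNy_compNP: cl.
- have cr : c y @[y --> +oo] --> derive1 fp Up.
    rewrite (_ : derive1 fp Up = coupled_speed fm fp 1 Up); last first.
      by rewrite /coupled_speed; field.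
    apply: cvgM; first exact: cvg_cst.
    apply: cvgD; (apply: cvgM; last (apply: cvg_comp; first exact: Ur)).
    + by apply: cvgB; [exact: cvg_cst|exact: c1].
    + exact: cgm.
    + by apply: cvgD; [exact: cvg_cst|exact: c1].
    + exact: cgp.
  exact: (bounded_profile_speed Ud Pd nt UB cr).
Qed.

Theorem theorem4p1 (R : realType) (fm fp : R -> R) (uL uR : R)
  (u U : R -> R) (um up Um Up : R)
  (hfm : admissible_flux fm) (hfp : admissible_flux fp)
  (hM : 0 < max_speed fm fp uL uR)
  (hlim : outer_inner_limits fm fp uL uR (max_speed fm fp uL uR) u U)
  (hu_bnd : bounded_fun u) (hu_BV : BV u) (hu_mono : monotone_fun u)
  (hum : u x @[x --> 0^'-] --> um) (hup : u x @[x --> 0^'+] --> up)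
  (hU : inner_profile fm fp U)
  (hUm : U y @[y --> -oo] --> Um) (hUp : U y @[y --> +oo] --> Up) :
  [/\ 0 <= (uR - uL) * (up - Up),
      fp Up = fp up,
      forall k, hull2 Up up k ->
        Num.sg (up - k) * (fp up - fp k) <= 0 /\
        0 <= Num.sg (Up - k) * (fp Up - fp k) &
      Up != up ->
        [/\ 0 <= derive1 fp Up, derive1 fp up <= 0 &
            genuinely_nonlinear fp -> 0 < derive1 fp Up /\ derive1 fp up < 0]] /\
  [/\ 0 <= (uR - uL) * (Um - um),
      fm um = fm Um,
      forall k, hull2 um Um k ->
        0 <= Num.sg (um - k) * (fm um - fm k) /\
        Num.sg (Um - k) * (fm Um - fm k) <= 0 &
      Um != um ->
        [/\ 0 <= derive1 fm um, derive1 fm Um <= 0 &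
            genuinely_nonlinear fm -> 0 < derive1 fm um /\ derive1 fm Um < 0]] /\
  (nontrivial_inner U ->
    [/\ Um != Up,
        0 < (uR - uL) * (Up - Um),
        0 <= derive1 fm Um &
        derive1 fp Up <= 0]).
Proof.
have [[fmd cgm] _ _] := hfm; have [[fpd cgp] _ _] := hfp.
have fmd' (w : R) : is_derive w 1 fm (derive1 fm w) by exact: derivable_derive1.
have fpd' (w : R) : is_derive w 1 fp (derive1 fp w) by exact: derivable_derive1.
have [ue [ve [eps [sol e0 ecvg ucvg Ucvg]]]] := hlim.
have W n := dafermos_coupled_wave (e0 n) (sol (eps n) (e0 n)).
have um_ n : monotone_fun (ue (eps n)) by exact: wave_monotone hM cgm cgp (W n).
have Um_ n : monotone_fun (fun y => ue (eps n) (eps n * y)).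
  by case: (um_ n) => h; [left|right] => x y xy; apply: h; rewrite ler_pM2l.
have outer_r := cvg_L1loc_right_trace ucvg um_ hup.
have outer_l := cvg_L1loc_left_trace ucvg um_ hum.
have inner_r := cvg_L1loc_pinfty Ucvg Um_ hUp.
have inner_l := cvg_L1loc_ninfty Ucvg Um_ hUm.
have [Or [fr sr tr]] := wave_right_trace hM cgm cgp fpd' e0 ecvg W outer_r inner_r.
have [Ol [fl sl tl]] := wave_left_trace hM cgm cgp fmd' e0 ecvg W outer_l inner_l.
split; [split => //|split; [split|]].
- exact: Ol.
- by apply: oppr_inj.
- move=> k; rewrite /hull2 minC maxC => /sl.
  have N (a b : R) : - a - - b = - (a - b) by ring.
  by rewrite !N !mulrN oppr_le0 oppr_ge0 => -[].
- move=> /tl[]; rewrite oppr_ge0 oppr_le0 => gl gr gn; split=> // nf.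
  have [] := gn (genuinely_nonlinear_opp nf).
  by rewrite oppr_gt0 oppr_lt0.
- move=> nt; have [neq gl gr] := nontrivial_inner_endpoints cgm cgp hU nt hUm hUp.
  split=> //; have := wave_inner_range hM cgm cgp e0 W inner_r inner_l.
  by apply: lt_le_trans; rewrite exprn_even_gt0//= subr_eq0 eq_sym.
Qed.
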